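(* Let $k\ge3$ and $n\ge k+1$ be integers. If there is an integer $m$ such that \[ \frac nk<m<\beta_k n, \] then $C_{n,k}^{\rm loc}<0$. In particular, if \[ n\left(\beta_k-\frac1k\right)>1, \] then the equal point is a saddle of $S_{n,k}$.
   Context: Indices are modulo $n$. For $x_i>0$, $S_{n,k}(x)=\sum_{i=1}^n\frac{x_i}{x_{i+1}+\cdots+x_{i+k}}$, homogeneous of degree $0$. The equal point is $(1,\dots,1)$ (considered up to common scaling), where $S_{n,k}=n/k$. Define \[ C_{n,k}^{\rm loc}=\min_{1\le m\le n-1}\frac{|\lambda_{m,k}|^2-k\operatorname{Re}\lambda_{m,k}}{k^3},\qquad \lambda_{m,k}=\sum_{j=1}^k e^{2\pi\mathrm{i} mj/n}. \] For $0<x<1$ let \[ A_k(x)=\frac{\sin(\pi kx)}{\sin(\pi x)},\qquad \Gamma_k(x)=\frac{A_k(x)\left(A_k(x)-k\cos(\pi(k+1)x)\right)}{k^3}, \] and let \[ \beta_k=\sup\left\{b>\tfrac1k:\ \Gamma_k(x)<0\ \text{for all}\ x\in\left(\tfrac1k,b\right)\right\} \] ($b$ ranging over $b\le 1$), the right endpoint of the first negative interval of $\Gamma_k$ after $1/k$; one has $\beta_k>1/k$. ''Saddle'' means: the equal point is a critical point of $S_{n,k}$ and every neighbourhood of it contains positive vectors with $S_{n,k}<n/k$ and positive vectors with $S_{n,k}>n/k$. *)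

(* Defs.v *)
From HB Require Import structures.
From mathcomp Require Export all_boot all_order all_algebra.
From mathcomp Require Export complex.
From mathcomp Require Export all_classical all_reals all_analysis.

Set Implicit Arguments.
Unset Strict Implicit.
Unset Printing Implicit Defensive.

Export Order.TTheory GRing.Theory Num.Theory.
Export numFieldNormedType.Exports.

Local Open Scope classical_set_scope.
Local Open Scope ring_scope.
Local Open Scope complex_scope.

(* [ordS] is the successor modulo n on 'I_n, so [iter j (@ordS n) i] is the
   index i + j modulo n; the indices are 0, ..., n - 1. *)
Definition Snk (R : realType) (n k : nat) (x : 'rV[R]_n) : R :=
  \sum_(i < n) x ord0 i / \sum_(1 <= j < k.+1) x ord0 (iter j (@ordS n) i).

Definition equal_point (R : realType) (n : nat) : 'rV[R]_n := const_mx 1.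

(* e^{i t} for real t. *)
Definition expi (R : realType) (t : R) : R[i] := cos t +i* sin t.

Definition lambda (R : realType) (n m k : nat) : R[i] :=
  \sum_(1 <= j < k.+1) expi (2 * pi * m%:R * j%:R / n%:R : R).

Definition Cloc_term (R : realType) (n k m : nat) : R :=
  let l := lambda R n m k in
  (Normc.normc l ^+ 2 - k%:R * complex.Re l) / k%:R ^+ 3.

(* The default value of the iterated minimum is the term m = 1, which belongs
   to the range as soon as n >= 2. *)
Definition Cloc (R : realType) (n k : nat) : R :=
  \big[Num.min/Cloc_term R n k 1]_(1 <= m < n) Cloc_term R n k m.

Definition Ak (R : realType) (k : nat) (x : R) : R :=
  sin (pi * k%:R * x) / sin (pi * x).

Definition Gammak (R : realType) (k : nat) (x : R) : R :=
  Ak k x * (Ak k x - k%:R * cos (pi * (k%:R + 1) * x)) / k%:R ^+ 3.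

Definition betak (R : realType) (k : nat) : R :=
  sup [set b : R | [/\ k%:R^-1 < b, b <= 1 &
    forall x : R, k%:R^-1 < x -> x < b -> Gammak k x < 0]].

Definition positive_vec (R : realType) (n : nat) (x : 'rV[R]_n) : Prop :=
  forall i, 0 < x ord0 i.

Definition critical_point (R : realType) (n : nat) (f : 'rV[R]_n -> R)
    (a : 'rV[R]_n) : Prop :=
  differentiable (f : 'rV[R]_n -> R^o) a /\
  forall v, 'd (f : 'rV[R]_n -> R^o) a v = 0.

Definition equal_point_saddle (R : realType) (n k : nat) : Prop :=
  critical_point (@Snk R n k) (equal_point R n) /\
  forall U : set 'rV[R]_n, nbhs (equal_point R n) U ->
    (exists x, [/\ U x, positive_vec x & Snk k x < n%:R / k%:R]) /\
    (exists x, [/\ U x, positive_vec x & n%:R / k%:R < Snk k x]).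

(* Main.v *)
(* With y = pi m / n, multiplying the sums for Re lambda and Im lambda by sin y
   telescopes them, which identifies the m-th term of Cloc with Gamma_k (m / n);
   so any m / n strictly between 1/k and beta_k makes Cloc negative, and a gap
   n (beta_k - 1/k) > 1 leaves room for the integer floor(n / k) + 1.

   For the saddle, put a = v_i and let b = b_i be the sum of the k entries
   following v_i.  The exact expansion of (1 + t a) / (k + t b) gives
   S(1 + t v) = n / k + t^2 (Q(v) / k^3 + t g(t)) with g continuous at 0 and
   Q(v) the sum of the b^2 - k a b; the linear terms cancel since each v_i lies
   in exactly k windows.  Q is positive on a coordinate vector, where a b = 0,
   and its values at the cosine and sine waves of frequency m add up to
   n k^3 times the m-th term of Cloc, so one of them is negative. *)
Require Import Defs.
From mathcomp Require Import ring lra.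

Local Open Scope classical_set_scope.
Local Open Scope ring_scope.

(** * Second-order expansion of [Snk] along lines through the equal point *)

Section Window.
Context {R : realType} {n : nat}.
Implicit Types (k : nat) (x v : 'rV[R]_n) (i : 'I_n).

Definition window k x i : R := \sum_(1 <= j < k.+1) x ord0 (iter j (@ordS n) i).

(* [k ^ 3] times the second-order Taylor coefficient of [Snk] at the equal
   point in the direction [v]. *)
Definition hess k v : R :=
  \sum_(i < n) (window k v i ^+ 2 - k%:R * v ord0 i * window k v i).

Lemma windowD k x v i : window k (x + v) i = window k x i + window k v i.
Proof. by rewrite -big_split; apply: eq_bigr => j _; rewrite mxE. Qed.

Lemma windowZ k (t : R) v i : window k (t *: v) i = t * window k v i.
Proof. by rewrite mulr_sumr; apply: eq_bigr => j _; rewrite mxE. Qed.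

Lemma window_equal_point k i : window k (equal_point R n) i = k%:R.
Proof.
rewrite /window (eq_bigr (fun=> 1)); last by move=> j _; rewrite mxE.
by rewrite sumr_const_nat subn1.
Qed.

Lemma sum_iter_ordS (F : 'I_n -> R) j :
  \sum_(i < n) F (iter j (@ordS n) i) = \sum_(i < n) F i.
Proof.
elim: j => [//|j IHj]; rewrite -IHj [RHS](reindex_inj (@ordS_inj n)) /=.
by apply: eq_bigr => i _; rewrite -iterSr.
Qed.

Lemma sum_window k v : \sum_(i < n) window k v i = k%:R * \sum_(i < n) v ord0 i.
Proof.
rewrite exchange_big /= (eq_bigr (fun=> \sum_(i < n) v ord0 i)).
  by rewrite sumr_const_nat subn1 mulr_natl.
by move=> j _; rewrite sum_iter_ordS.
Qed.

Lemma val_iter_ordS j i : iter j (@ordS n) i = ((i + j) %% n)%N :> nat.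
Proof.
elim: j => [|j IHj]; first by rewrite addn0 modn_small.
by rewrite iterS /= IHj -addn1 modnDml addn1 addnS.
Qed.

(** Exact coefficient of t^3, with a = v_i and b = [window k v i]: it comes from 1/(k + tb) = 1/k -
    tb/k^2 + t^2 b^2/k^3 - t^3 b^3/(k^3 (k + tb)), multiplied by 1 + ta. *)
Definition remainder k v (t : R) : R :=
  \sum_(i < n) (v ord0 i * window k v i ^+ 2 -
    (1 + t * v ord0 i) * window k v i ^+ 3 / (k%:R + t * window k v i)) /
    k%:R ^+ 3.

Lemma Snk_line k v t : (0 < k)%N ->
  (forall i, k%:R + t * window k v i != 0) ->
  Snk k (equal_point R n + t *: v) =
    n%:R / k%:R + t ^+ 2 * (hess k v / k%:R ^+ 3 + t * remainder k v t).
Proof.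
move=> k0 den0; have kN0 : k%:R != 0 :> R by rewrite pnatr_eq0 -lt0n.
have -> : Snk k (equal_point R n + t *: v) =
  \sum_(i < n) (1 + t * v ord0 i) / (k%:R + t * window k v i).
  apply: eq_bigr => i _; rewrite -/(window k _ i) windowD windowZ.
  by rewrite window_equal_point !mxE.
have linear0 : \sum_(i < n) (t / k%:R * v ord0 i - t / k%:R ^+ 2 * window k v i) = 0.
  by rewrite sumrB -!mulr_sumr sum_window; field.
(* Subtracting the vanishing linear sum turns the claim into an identity between summands of the
   same index. *)
rewrite mulrDr -[LHS]subr0 -[X in _ - X]linear0 -sumrB.
have -> : n%:R / k%:R = \sum_(i < n) k%:R^-1 :> R.
  by rewrite sumr_const card_ord mulr_natl.
rewrite /hess /remainder [hess _ _ / _]mulr_suml !mulr_sumr -!big_split /=.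
by apply: eq_bigr => i _; field; rewrite kN0 den0.
Qed.

Lemma near_den_neq0 k v : (0 < k)%N ->
  \forall t \near (0 : R), forall i, k%:R + t * window k v i != 0.
Proof.
move=> k0; near=> t => i; move: i; near: t; apply: filter_forall => i.
have : k%:R + t * window k v i @[t --> (0 : R)] --> k%:R + 0 * window k v i.
  by apply: cvgD; [exact: cvg_cst | apply: cvgMr_tmp; exact: cvg_id].
by move/cvgr_neq0; apply; rewrite mul0r addr0 pnatr_eq0 -lt0n.
Unshelve. all: by end_near. Qed.

Lemma cvg_second_order k v : (0 < k)%N ->
  hess k v / k%:R ^+ 3 + t * remainder k v t @[t --> (0 : R)] -->
  hess k v / k%:R ^+ 3.
Proof.
(* The limit is written with the extra term [0 * remainder k v 0], so that it follows from
   continuity at 0; the denominators tend to k. *)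
move=> k0; rewrite -[X in _ --> X]addr0 -[X in _ + X](mul0r (remainder k v 0)).
apply: cvgD; first exact: cvg_cst.
apply: cvgM; first exact: cvg_id.
apply: cvg_big => [|i _]; first exact: add_continuous.
apply: cvgMr_tmp; apply: cvgB; first exact: cvg_cst.
apply: cvgM.
  apply: cvgMr_tmp; apply: cvgD; first exact: cvg_cst.
  by apply: cvgMr_tmp; exact: cvg_id.
apply: cvgV; first by rewrite mul0r addr0 pnatr_eq0 -lt0n.
by apply: cvgD; [exact: cvg_cst | apply: cvgMr_tmp; exact: cvg_id].
Qed.

Lemma near_line_Snk k v (U : set 'rV[R]_n) : (0 < k)%N ->
  nbhs (equal_point R n) U ->
  \forall t \near (0 : R)^', let x := equal_point R n + t *: v in
    [/\ U x, positive_vec x & Snk k x =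
      n%:R / k%:R + t ^+ 2 * (hess k v / k%:R ^+ 3 + t * remainder k v t)].
Proof.
move=> k0 nU.
have line_cvg : equal_point R n + t *: v @[t --> (0 : R)] --> equal_point R n.
  rewrite -[X in _ --> X]addr0 -[X in _ + X](scale0r v).
  by apply: cvgD; [exact: cvg_cst | apply: cvgZr_tmp; exact: cvg_id].
apply: nbhs_dnbhs; near=> t; split.
- by near: t; exact: line_cvg.
- move=> i; move: i; near: t; apply: filter_forall => i.
  have coord_cvg : (equal_point R n + t *: v) ord0 i @[t --> (0 : R)] --> (1 : R).
    have -> : (1 : R) = equal_point R n ord0 i by rewrite mxE.
    exact: (cvg_comp _ _ line_cvg (@coord_continuous _ _ _ _ _ _)).
  by apply: cvgr_gt coord_cvg _ _; exact: ltr01.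
- by apply: Snk_line => //; near: t; exact: near_den_neq0.
Unshelve. all: by end_near. Qed.

(** Serves both signs: [A] will be the positive or the negative half-line, and [e] is t^2 for a
    small nonzero t. *)
Lemma Snk_perturb k v (U : set 'rV[R]_n) (A : set R) : (0 < k)%N ->
  nbhs (equal_point R n) U -> nbhs (hess k v / k%:R ^+ 3) A ->
  exists x e c, [/\ U x, positive_vec x, 0 < e, A c &
    Snk k x = n%:R / k%:R + e * c].
Proof.
move=> k0 nU nA; have [t [tN0 [Ut pt SE] At]] : exists t : R, [/\ t != 0,
    let x := equal_point R n + t *: v in
    [/\ U x, positive_vec x & Snk k x =
      n%:R / k%:R + t ^+ 2 * (hess k v / k%:R ^+ 3 + t * remainder k v t)] &
    A (hess k v / k%:R ^+ 3 + t * remainder k v t)].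
  apply: (@filter_ex _ (0 : R)^'); near=> t; split.
  - by near: t; exact: nbhs_dnbhs_neq.
  - by near: t; exact: near_line_Snk.
  - by near: t; apply: nbhs_dnbhs; exact: (cvg_second_order k v k0 _ nA).
exists (equal_point R n + t *: v), (t ^+ 2); eexists; split; [..|exact: SE] => //.
by rewrite exprn_even_gt0.
Unshelve. all: by end_near. Qed.

Lemma hess_gt0_Snk k v (U : set 'rV[R]_n) : (0 < k)%N -> 0 < hess k v ->
  nbhs (equal_point R n) U ->
  exists x, [/\ U x, positive_vec x & n%:R / k%:R < Snk k x].
Proof.
move=> k0 hv nU.
have q0 : 0 < hess k v / k%:R ^+ 3 by rewrite divr_gt0 // exprn_gt0 // ltr0n.
have [x [e [c [Ux px e0 c0 SE]]]] := Snk_perturb k v _ _ k0 nU (lt_nbhsr q0).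
by exists x; split; rewrite // SE ltrDl mulr_gt0.
Qed.

Lemma hess_lt0_Snk k v (U : set 'rV[R]_n) : (0 < k)%N -> hess k v < 0 ->
  nbhs (equal_point R n) U ->
  exists x, [/\ U x, positive_vec x & Snk k x < n%:R / k%:R].
Proof.
move=> k0 hv nU.
have q0 : hess k v / k%:R ^+ 3 < 0 
  by rewrite pmulr_llt0 // invr_gt0 exprn_gt0 // ltr0n.
have [x [e [c [Ux px e0 c0 SE]]]] := Snk_perturb k v _ _ k0 nU (lt_nbhsl q0).
by exists x; split; rewrite // SE gtrDl pmulr_rlt0.
Qed.

Lemma differentiable_Snk k : (0 < k)%N ->
  differentiable (@Snk R n k : 'rV[R]_n -> R^o) (equal_point R n).
Proof.
move=> k0.
have -> : @Snk R n k = \sum_(i < n) (fun x => x ord0 i / window k x i).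
  by apply/funext => x; rewrite fct_sumE.
apply: differentiable_sum => i; apply: differentiableM.
  exact: differentiable_coord.
apply: differentiableV; last by rewrite window_equal_point pnatr_eq0 -lt0n.
have -> : window k ^~ i = \sum_(j < k) (fun x => x ord0 (iter j.+1 (@ordS n) i)).
  by apply/funext => x; rewrite fct_sumE /window big_add1 /= big_mkord.
by apply: differentiable_sum => j; exact: differentiable_coord.
Qed.

(** By [Snk_line] the difference quotient along [v] is [t] times a convergent factor, so every
    directional derivative is 0. *)
Lemma critical_point_Snk k : (0 < k)%N ->
  critical_point (@Snk R n k) (equal_point R n).
Proof.
move=> k0; have dS := differentiable_Snk k k0; split=> // v.
rewrite -deriveE //; apply: cvg_lim => //.
have Sn0 : Snk k (equal_point R n) = n%:R / k%:R.
  have := @Snk_line k 0 0 k0; rewrite scaler0 addr0 expr0n mul0r addr0; apply.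
  by move=> i; rewrite mul0r addr0 pnatr_eq0 -lt0n.
have step : t * (hess k v / k%:R ^+ 3 + t * remainder k v t) @[t --> (0 : R)] -->
    0 * (hess k v / k%:R ^+ 3).
  by apply: cvgM; [exact: cvg_id | exact: cvg_second_order].
rewrite mul0r in step.
apply: cvg_trans (fun A nA => nbhs_dnbhs (step A nA)).
apply: near_eq_cvg; near=> t.
have tN0 : t != 0 by near: t; exact: nbhs_dnbhs_neq.
have den0 : forall i, k%:R + t * window k v i != 0.
  by near: t; apply: nbhs_dnbhs; exact: near_den_neq0.
rewrite /= [_ + equal_point _ _]addrC Snk_line // Sn0 addrAC subrr add0r.
by rewrite /GRing.scale /= expr2 !mulrA mulVf // mul1r.
Unshelve. all: by end_near. Qed.

(** * A direction of positive curvature *)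

Definition spike (i0 : 'I_n) : 'rV[R]_n := \row_i (i == i0)%:R.

Lemma window_spike_ge0 k i0 i : 0 <= window k (spike i0) i.
Proof. by apply: sumr_ge0 => j _; rewrite mxE ler0n. Qed.

(** The window of [i0] runs over i0 + 1, ..., i0 + k and cannot return to [i0] when k < n. *)
Lemma window_spike_self k i0 : (k < n)%N -> window k (spike i0) i0 = 0.
Proof.
move=> kn; rewrite /window big_seq big1 // => j; rewrite mem_index_iota mxE.
move=> /andP[j0 jk]; case: eqP => // /(congr1 val) /=; rewrite val_iter_ordS.
rewrite -{2}(modn_small (ltn_ord i0)) -{2}[i0 : nat]addn0 => /eqP.
by rewrite eqn_modDl mod0n modn_small ?(leq_trans jk) // => /eqP j00;
  rewrite j00 in j0.
Qed.

Lemma window_spike_pred_gt0 k i0 : (0 < k)%N ->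
  0 < window k (spike i0) (ord_pred i0).
Proof.
move=> k0; rewrite /window big_ltn //= mxE ord_predK eqxx ltr_pwDl ?ltr01 //.
by apply: sumr_ge0 => j _; rewrite mxE ler0n.
Qed.

Lemma hess_spike_gt0 k i0 : (0 < k < n)%N -> 0 < hess k (spike i0).
Proof.
move=> /andP[k0 kn].
have -> : hess k (spike i0) = \sum_(i < n) window k (spike i0) i ^+ 2.
  apply: eq_bigr => i _; rewrite mxE.
  have [->|_] := eqVneq i i0; last by rewrite mulr0 mul0r subr0.
  by rewrite window_spike_self // mulr0 subr0.
(* The window of the predecessor starts at [i0], so its square makes the sum strictly positive. *)
rewrite (bigD1 (ord_pred i0)) //= ltr_pwDl ?exprn_gt0 ?window_spike_pred_gt0 //.
by apply: sumr_ge0 => i _; rewrite exprn_ge0 ?window_spike_ge0.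
Qed.

End Window.

(** * Closed forms of the trigonometric sums, and the sign of [Cloc] *)

Lemma sum_cos_double {R : realType} (k : nat) (y : R) :
  (\sum_(1 <= j < k.+1) cos (2 * y * j%:R)) * sin y =
  sin (k%:R * y) * cos ((k%:R + 1) * y).
Proof.
elim: k => [|k IHk]; first by rewrite big_nil !mul0r sin0 mul0r.
rewrite big_nat_recr //= mulrDl IHk -!(natr1 k); set a := (k%:R + 1) * y.
have -> : k%:R * y = a - y by rewrite /a; ring.
have -> : 2 * y * (k%:R + 1) = a + a by rewrite /a; ring.
have -> : (k%:R + 1 + 1) * y = a + y by rewrite /a; ring.
by rewrite sinB !cosD; ring.
Qed.

Lemma sum_sin_double {R : realType} (k : nat) (y : R) :
  (\sum_(1 <= j < k.+1) sin (2 * y * j%:R)) * sin y =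
  sin (k%:R * y) * sin ((k%:R + 1) * y).
Proof.
elim: k => [|k IHk]; first by rewrite big_nil !mul0r sin0 mul0r.
rewrite big_nat_recr //= mulrDl IHk -!(natr1 k); set a := (k%:R + 1) * y.
have -> : k%:R * y = a - y by rewrite /a; ring.
have -> : 2 * y * (k%:R + 1) = a + a by rewrite /a; ring.
have -> : (k%:R + 1 + 1) * y = a + y by rewrite /a; ring.
by rewrite sinB !sinD; ring.
Qed.

Definition freq (R : realType) (n m : nat) : R := 2 * pi * m%:R / n%:R.

Lemma Re_lambda {R : realType} (n m k : nat) :
  complex.Re (lambda R n m k) = \sum_(1 <= j < k.+1) cos (freq R n m * j%:R).
Proof.
rewrite /lambda raddf_sum.
by apply: eq_bigr => j _; rewrite /= /freq mulrAC.
Qed.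

Lemma Im_lambda {R : realType} (n m k : nat) :
  complex.Im (lambda R n m k) = \sum_(1 <= j < k.+1) sin (freq R n m * j%:R).
Proof.
rewrite /lambda raddf_sum.
by apply: eq_bigr => j _; rewrite /= /freq mulrAC.
Qed.

Lemma Cloc_termE {R : realType} (n k m : nat) (p := complex.Re (lambda R n m k))
    (q := complex.Im (lambda R n m k)) :
  Cloc_term R n k m = (p ^+ 2 + q ^+ 2 - k%:R * p) / k%:R ^+ 3.
Proof.
rewrite /Cloc_term /Normc.normc /p /q; case: (lambda R n m k) => a b /=.
by rewrite sqr_sqrtr // addr_ge0 ?sqr_ge0.
Qed.

(** With y = pi m / n, the closed forms give Re lambda = A_k cos((k + 1) y) and Im lambda = A_k
    sin((k + 1) y), hence |lambda|^2 = A_k^2. *)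
Lemma Cloc_term_Gammak {R : realType} (n k m : nat) : (0 < m < n)%N ->
  Cloc_term R n k m = Gammak k (m%:R / n%:R : R).
Proof.
move=> /andP[m0 mn]; have n0 : 0 < n%:R :> R by rewrite ltr0n (leq_trans _ mn).
set x : R := m%:R / n%:R; set y := pi * x.
have sy0 : sin y != 0.
  apply: lt0r_neq0; apply: sin_gt0_pi; rewrite /y /x; apply/andP; split.
    by rewrite mulr_gt0 ?pi_gt0 // divr_gt0 // ltr0n.
  by rewrite gtr_pMr ?pi_gt0 // ltr_pdivrMr // mul1r ltr_nat.
have freqE : freq R n m = 2 * y by rewrite /freq /y /x; ring.
rewrite Cloc_termE Re_lambda Im_lambda freqE /Gammak /Ak.
have -> : pi * k%:R * x = k%:R * y by rewrite /y; ring.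
have -> : pi * (k%:R + 1) * x = (k%:R + 1) * y by rewrite /y; ring.
rewrite -/y.
rewrite -(mulfK sy0 (\sum_(_ <= _ < _) cos _)) sum_cos_double.
rewrite -(mulfK sy0 (\sum_(_ <= _ < _) sin _)) sum_sin_double.
set c := cos ((k%:R + 1) * y); set s := sin ((k%:R + 1) * y).
have sE : s ^+ 2 = 1 - c ^+ 2 by rewrite /s sin2cos2.
congr (_ / _); rewrite !exprMn sE; ring.
Qed.

Lemma Cloc_lt0P {R : realType} (n k : nat) : (1 < n)%N ->
  Cloc R n k < 0 <-> exists2 m, (0 < m < n)%N & Cloc_term R n k m < 0.
Proof.
move=> n1; split=> [Clt0|[m /andP[m0 mn] ?]]; last first.
  apply: le_lt_trans _ (_ : Cloc_term R n k m < 0) => //.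
  rewrite /Cloc; apply: bigmin_inf_seq (lexx _) => //.
  by rewrite mem_index_iota m0.
apply: contrapT => nex; move: Clt0; rewrite ltNge => /negP; apply.
have ge0 m : (0 < m < n)%N -> 0 <= Cloc_term R n k m.
  by move=> mn; rewrite leNgt; apply/negP => ?; apply: nex; exists m.
(* The first case is the default term m = 1, which lies in the range since n > 1. *)
rewrite /Cloc big_seq; elim/big_ind: _ => [|x y x0 y0|m].
- exact: ge0.
- by rewrite le_min x0.
- by rewrite mem_index_iota; exact: ge0.
Qed.

Lemma Gammak_lt0_betak {R : realType} (k : nat) (x : R) :
  k%:R^-1 < x -> x < betak R k -> Gammak k x < 0 /\ x < 1.
Proof.
rewrite /betak => kx; set E := [set b | _] => xE.
have [b [kb b1 Gb] xb] : exists2 b, E b & x < b.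
  (* If [E] is empty, its [sup] is 0 by convention, contradicting 0 <= 1/k < x < sup. *)
  have [E0|/set0P EN0] := eqVneq E set0; last exact: sup_gt.
  by move: xE; rewrite E0 sup0 ltNge (ltW (le_lt_trans _ kx)) // invr_ge0.
by split; [exact: Gb|exact: lt_le_trans xb b1].
Qed.

Lemma Cloc_lt0 {R : realType} (n k : nat) (m : int) : (1 < n)%N ->
  n%:R / k%:R < m%:~R :> R -> m%:~R < betak R k * n%:R -> Cloc R n k < 0.
Proof.
move=> n1; have n0 : 0 < n%:R :> R by rewrite ltr0n (leq_trans _ n1).
(* A negative integer cannot exceed n / k, so [m] is a natural number. *)
case: m => [m|m] km mb; last first.
  by move: km; rewrite ltNge (le_trans (ltW (_ : _ < 0))) ?divr_ge0 // ltrz0.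
rewrite -pmulrn in km mb.
have kx : k%:R^-1 < m%:R / n%:R :> R by rewrite ltr_pdivlMr // mulrC.
have [|G0 x1] := @Gammak_lt0_betak R k _ kx; first by rewrite ltr_pdivrMr.
have mn : (0 < m < n)%N.
  rewrite -(ltr_nat R 0 m) (le_lt_trans _ km) ?divr_ge0 //=.
  by move: x1; rewrite ltr_pdivrMr // mul1r ltr_nat.
by apply/(Cloc_lt0P n k n1); exists m => //; rewrite Cloc_term_Gammak.
Qed.

(** * Fourier modes and directions of negative curvature *)

Section Waves.
Context {R : realType} (n m : nat).
Let theta := freq R n m.

Definition cos_wave : 'rV[R]_n := \row_i cos (theta * i%:R).
Definition sin_wave : 'rV[R]_n := \row_i sin (theta * i%:R).

(** Since theta n = 2 pi m, reducing an index modulo n shifts the phase by whole periods; the waves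
    are thus well defined on the cycle. *)
Lemma freq_modn (l : nat) : (0 < n)%N ->
  theta * l%:R = theta * (l %% n)%:R + (pi *+ 2) *+ (m * (l %/ n)).
Proof.
move=> n0; rewrite {1}(divn_eq l n) /theta /freq natrD natrM.
rewrite -(mulr_natr (pi *+ 2)) -(mulr_natr pi 2) natrM.
by field; rewrite pnatr_eq0 -lt0n.
Qed.

Lemma cos_freq_modn (l : nat) : (0 < n)%N ->
  cos (theta * (l %% n)%:R) = cos (theta * l%:R).
Proof. by move=> n0; rewrite (freq_modn l n0) periodicn //; exact: cosD2pi. Qed.

Lemma sin_freq_modn (l : nat) : (0 < n)%N ->
  sin (theta * (l %% n)%:R) = sin (theta * l%:R).
Proof. by move=> n0; rewrite (freq_modn l n0) periodicn //; exact: sinD2pi. Qed.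

(** The two waves are the real and imaginary parts of an eigenvector of the window operator with
    eigenvalue lambda. *)
Lemma window_cos_wave (k : nat) (i : 'I_n) :
  window k cos_wave i = complex.Re (lambda R n m k) * cos (theta * i%:R) -
    complex.Im (lambda R n m k) * sin (theta * i%:R).
Proof.
have n0 : (0 < n)%N by apply: leq_trans (ltn_ord i).
rewrite Re_lambda Im_lambda !mulr_suml -sumrB; apply: eq_bigr => j _.
by rewrite mxE val_iter_ordS cos_freq_modn // natrD mulrDr cosD /theta; ring.
Qed.

Lemma window_sin_wave (k : nat) (i : 'I_n) :
  window k sin_wave i = complex.Im (lambda R n m k) * cos (theta * i%:R) +
    complex.Re (lambda R n m k) * sin (theta * i%:R).
Proof.
have n0 : (0 < n)%N by apply: leq_trans (ltn_ord i).
rewrite Re_lambda Im_lambda !mulr_suml -big_split; apply: eq_bigr => j _ /=.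
by rewrite mxE val_iter_ordS sin_freq_modn // natrD mulrDr sinD /theta; ring.
Qed.

(** At each index the squared windows of the two waves add up to |lambda|^2, and the products of
    entry and window to Re lambda, so the combined summand is constant. *)
Lemma hess_waves (k : nat) : (0 < k)%N ->
  hess k cos_wave + hess k sin_wave = n%:R * k%:R ^+ 3 * Cloc_term R n k m.
Proof.
move=> k0; rewrite -mulrA Cloc_termE [k%:R ^+ 3 * _]mulrC divfK; last first.
  by rewrite expf_neq0 // pnatr_eq0 -lt0n.
rewrite mulr_natl -[X in _ *+ X]card_ord -sumr_const -big_split.
apply: eq_bigr => i _ /=; rewrite window_cos_wave window_sin_wave !mxE.
set p := complex.Re _; set q := complex.Im _; set t := theta * _.
have sE : sin t ^+ 2 = 1 - cos t ^+ 2 by exact: sin2cos2.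
(* Restoring the factor cos^2 + sin^2 = 1 makes both sides equal as polynomials in [p], [q],
   [cos t], [sin t]. *)
have -> : p ^+ 2 + q ^+ 2 - k%:R * p =
    (p ^+ 2 + q ^+ 2 - k%:R * p) * (cos t ^+ 2 + sin t ^+ 2).
  by rewrite cos2Dsin2 mulr1.
ring.
Qed.

Lemma hess_wave_lt0 (k : nat) : (0 < k)%N -> (0 < n)%N ->
  Cloc_term R n k m < 0 -> exists v : 'rV[R]_n, hess k v < 0.
Proof.
move=> k0 n0 C0; have : hess k cos_wave + hess k sin_wave < 0.
  by rewrite hess_waves // pmulr_rlt0 // mulr_gt0 ?exprn_gt0 ?ltr0n.
have [c0 _|c0 cs] := ltP (hess k cos_wave) 0; first by exists cos_wave.
by exists sin_wave; lra.
Qed.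

End Waves.

(** * From a negative mode to the saddle *)

Lemma Cloc_lt0_saddle {R : realType} (n k : nat) : (0 < k < n)%N ->
  Cloc R n k < 0 -> equal_point_saddle R n k.
Proof.
move=> /andP[k0 kn]; have n0 : (0 < n)%N by exact: leq_trans kn.
move=> /(Cloc_lt0P n k (leq_ltn_trans k0 kn))[m _ /(hess_wave_lt0 _ _ _ k0 n0)[v hv]].
split=> [|U nU]; first exact: critical_point_Snk.
split; first exact: hess_lt0_Snk hv nU.
by apply: hess_gt0_Snk (hess_spike_gt0 k (Ordinal n0) _) nU; rewrite ?k0.
Qed.

Theorem corollary8p1 (R : realType) (n k : nat) (hk : (3 <= k)%N)
    (hn : (k.+1 <= n)%N) :
  ((exists m : int, n%:R / k%:R < m%:~R :> R /\ m%:~R < betak R k * n%:R) ->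
     Cloc R n k < 0) /\
  (1 < n%:R * (betak R k - k%:R^-1) -> equal_point_saddle R n k).
Proof.
have k0 : (0 < k)%N by exact: leq_trans hk.
have n1 : (1 < n)%N by exact: leq_ltn_trans hn.
have part1 : (exists m : int, n%:R / k%:R < m%:~R :> R /\
    m%:~R < betak R k * n%:R) -> Cloc R n k < 0.
  by move=> [m [km mb]]; exact: Cloc_lt0 km mb.
split=> // gap; apply: Cloc_lt0_saddle; rewrite ?k0 //; apply: part1.
exists (Num.floor (n%:R / k%:R : R) + 1); rewrite floorD1_gt //; split=> //.
(* The witness is at most n/k + 1, and [gap] says n/k + 1 < beta_k n. *)
have := floor_le (n%:R / k%:R : R); rewrite intrD.
by lra.
Qed.
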